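(* Let $\tau,k$ be integers such that $\tau-1\geq k\geq 1$. Let $D=(V,A)$ be a digraph such that $d_A^+(U)+\left(\frac{\tau}{k}-1\right)d_A^-(U)\geq\tau$ for all $U\subsetneq V$, $U\neq\emptyset$. Then $A$ can be decomposed (partitioned) into a $k$-arc-connected flip of $D$ and a $(\tau-k)$-dijoin of $D$.
   Context: Digraphs are finite and may have parallel arcs. For a digraph $D=(V,A)$ and $U\subseteq V$, $\delta^+(U)$ and $\delta^-(U)$ denote the sets of arcs leaving and entering $U$, respectively. For $J\subseteq A$, $d_J^+(U):=|\delta^+(U)\cap J|$ and $d_J^-(U):=|\delta^-(U)\cap J|$. A $k$-arc-connected flip of $D$ is a subset $J\subseteq A$ such that after reversing the arcs of $J$ the digraph becomes (strongly) $k$-arc-connected, i.e. $d_J^+(U)+d_A^-(U)-d_J^-(U)\geq k$ for all $U\subsetneq V$, $U\neq\emptyset$. A dicut of $D$ is an arc subset of the form $\delta^+(U)$ where $U\subsetneq V$, $U\neq\emptyset$ and $\delta^-(U)=\emptyset$. For an integer $m\geq 1$, an $m$-dijoin of $D$ is a subset of $A$ that intersects every dicut of $D$ in at least $m$ arcs. *)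

(* Defs.v *)
From mathcomp Require Import all_boot all_order all_algebra.

Set Implicit Arguments.
Unset Strict Implicit.
Unset Printing Implicit Defensive.

(* Arcs form a separate finite type, so parallel arcs are distinct elements;
   loops are not excluded (they belong to no cut). *)
Record digraph := Digraph {
  vertices : finType;
  arcs : finType;
  arc_tail : arcs -> vertices;
  arc_head : arcs -> vertices
}.

Section Digraph.

Variable D : digraph.
Implicit Types (U : {set vertices D}) (J B : {set arcs D}).

Definition delta_out U : {set arcs D} :=
  [set a | (arc_tail a \in U) && (arc_head a \notin U)].

Definition delta_in U : {set arcs D} :=
  [set a | (arc_head a \in U) && (arc_tail a \notin U)].

Definition dout J U : nat := #|delta_out U :&: J|.

Definition din J U : nat := #|delta_in U :&: J|.

Definition nontrivial U : Prop := U != set0 /\ U \proper [set: vertices D].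

Definition reverse J : digraph :=
  @Digraph (vertices D) (arcs D)
    (fun a => if a \in J then arc_head a else arc_tail a)
    (fun a => if a \in J then arc_tail a else arc_head a).

Definition dicut B : Prop :=
  exists U, [/\ nontrivial U, delta_in U = set0 & B = delta_out U].

Definition dijoin (m : nat) J : Prop :=
  forall B, dicut B -> m <= #|J :&: B|.

End Digraph.

(* Bounding entering arcs for all U also bounds leaving arcs, by taking
   complements. *)
Definition arc_connected (k : nat) (D : digraph) : Prop :=
  forall U : {set vertices D}, nontrivial U -> k <= #|delta_in U|.

Definition arc_connected_flip (k : nat) (D : digraph) (J : {set arcs D}) : Prop :=
  arc_connected k (reverse J).

Arguments arc_connected_flip k D J : clear implicits.
Arguments dijoin D m J : clear implicits.

Lemma arc_connected_flipP (k : nat) (D : digraph) (J : {set arcs D}) :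
  arc_connected_flip k D J <->
  forall U : {set vertices D}, nontrivial U ->
    k <= dout J U + din [set: arcs D] U - din J U.
Proof.
have E (U : {set vertices D}) :
    #|@delta_in (reverse J) U| = dout J U + din [set: arcs D] U - din J U.
  rewrite /dout /din setIT -addnBA ?subset_leq_card ?subsetIl // -cardsD.
  rewrite -(cardsID J (@delta_in (reverse J) U)); congr (_ + _).
    apply: eq_card => a; rewrite !inE /=.
    by case: (a \in J); rewrite ?andbF.
  by apply: eq_card => a; rewrite !inE /=; case: (a \in J).
by split=> H U HU; [rewrite -E; apply: H | rewrite E; apply: H].
Qed.

(* Main.v *)
Require Import Defs.
From mathcomp Require Import all_boot all_order all_algebra.
From mathcomp Require Import zify ring lra.

Set Implicit Arguments.
Unset Strict Implicit.
Unset Printing Implicit Defensive.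
Import Order.TTheory GRing.Theory Num.Theory.

(**
For J a set of arcs, let net J v be the number of arcs of J leaving v minus
the number entering v; summed over U this is d_J^+(U) - d_J^-(U).  Both
properties wanted of J depend on x = net J only: J is a k-arc-connected flip
iff x(W) <= d^+(W) - k for all nontrivial W (take W to be the complement of U
in the definition of a flip), and the complement of J is a (tau-k)-dijoin iff
x(U) <= d^+(U) - (tau-k) for all nontrivial U without entering arcs.

Conversely, any integral x of total 0 with x(U) <= d^+(U) for all U is net J
for some J (realize_net).  This is an augmenting path argument, and the bound
it needs is already implied by the first family of inequalities.  So it
suffices to find an integral x satisfying both systems.  The hypothesis says
that the vector (k/tau) net A satisfies the first one, and it implies that this
vector satisfies the second one as well (integral_net).

Each system comes from a function that is submodular on a crossing family, and
in the intersection of two such systems a rational point can be replaced by an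
integral one (crossing_rounding).  At a solution y the tight sets of either
system are closed under intersection of crossing pairs.  Call two elements
equivalent when the same tight sets contain them; the value of y on each class
is then an integer (sum_atom_int), so no class contains exactly one element at
which y is not integral.  The two partitions into classes, restricted to these
elements, thus have together at most as many classes as there are elements;
their class indicators are linearly dependent, so there is a nonzero vector z
supported on these elements that sums to 0 over every class of either
partition (fibre_balanced).  Moving y along z keeps all tight sets tight, and
going as far as possible makes another set tight; repeating this ends at an
integral solution.
*)

(** * Classes of a family closed under crossing intersections *)

Section Hull.

Local Open Scope ring_scope.
Variables (V : finType) (T : {set {set V}}).
Hypothesis T_crossing : forall X Y, X \in T -> Y \in T ->
  X :&: Y != set0 -> X :|: Y != [set: V] -> X :&: Y \in T.

(** Two elements have the same hull exactly when the same members of T contain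
    them, so the fibres of hull are the classes of elements that T does not
    separate. *)
Definition hull (v : V) : {set V} := \bigcap_(U in T | v \in U) U.

Lemma hull_refl v : v \in hull v.
Proof. by apply/bigcapP => U /andP[]. Qed.

Lemma hull_sub U u : U \in T -> u \in U -> hull u \subset U.
Proof. by move=> UT uU; apply: bigcap_inf; rewrite UT. Qed.

Lemma hull_closed u v : u \in hull v -> hull u \subset hull v.
Proof.
move=> /bigcapP uv; apply/bigcapsP => U /andP[UT vU].
by apply: hull_sub => //; apply: uv; rewrite UT.
Qed.

(** A set that contains the hulls of its elements is a union of fibres of
    hull.  Members of T are such sets, and so are the hulls themselves. *)
Lemma sum_hull_closed (R : nmodType) (S : {set V}) (f : V -> R) :
  (forall u, u \in S -> hull u \subset S) ->
  \sum_(v in S) f v = \sum_(H in hull @: S) \sum_(v | hull v == H) f v.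
Proof.
move=> S_closed; rewrite (partition_big_imset hull) /=.
apply: eq_bigr => _ /imsetP[u uS ->]; apply: eq_bigl => v.
apply/andb_idl => /eqP hvu; apply: (subsetP (S_closed u uS)).
by rewrite -hvu hull_refl.
Qed.

(** The hull of v is the intersection of the minimal members of T containing v.
    If two of these did not cover everything, their intersection would be a
    smaller member containing v; hence their complements are disjoint, and the
    sum over the complement of the hull is the sum over these complements. *)
Lemma sum_hull_int (y : V -> rat) v :
  (forall U, U \in T -> \sum_(u in U) y u \is a Num.int) ->
  \sum_u y u \is a Num.int -> \sum_(u in hull v) y u \is a Num.int.
Proof.
move=> yT yV.
pose M := [set U | minset (fun U => (U \in T) && (v \in U)) U].
have MT U : U \in M -> (U \in T) && (v \in U) by rewrite inE => /minsetp.
have hullM : ~: hull v = cover [set ~: U | U in M].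
  apply/setP => u; rewrite inE; apply/idP/idP.
  - apply: contraNT => noM; apply/bigcapP => U PU.
    have [W WM WU] := minset_exists (P := fun U => (U \in T) && (v \in U)) PU.
    apply: (subsetP WU); apply: contraNT noM => uW.
    by apply/bigcupP; exists (~: W); rewrite ?inE // imset_f // inE.
  - case/bigcupP=> _ /imsetP[U UM ->]; rewrite inE; apply: contra.
    by move/bigcapP; apply; apply: MT.
have trivM : trivIset [set ~: U | U in M].
  apply/trivIsetP => _ _ /imsetP[X XM ->] /imsetP[Y YM ->] XY.
  rewrite -setI_eq0 -setCU.
  apply: contraNT XY => XY; apply/eqP; congr (~: _).
  have /andP[XT vX] := MT _ XM; have /andP[YT vY] := MT _ YM.
  have IP : (X :&: Y \in T) && (v \in X :&: Y).
    rewrite in_setI vX vY !andbT; apply: T_crossing => //.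
      by apply/set0Pn; exists v; rewrite inE vX.
    by apply: contra XY => /eqP ->; rewrite setCT.
  move: XM YM; rewrite !inE => /minsetP[_ minX] /minsetP[_ minY].
  exact: etrans (esym (minX _ IP (subsetIl _ _))) (minY _ IP (subsetIr _ _)).
have yC (U : {set V}) : \sum_(u in U) y u = \sum_u y u - \sum_(u in ~: U) y u.
  rewrite [X in _ - X](eq_bigl (fun u => u \notin U)) => [|u].
    by rewrite [X in X - _](bigID (mem U)) /= addrK.
  by rewrite inE.
rewrite yC hullM big_trivIset //= rpredB // rpred_sum // => _ /imsetP[U UM ->].
have /andP[UT _] := MT _ UM.
by have := yT U UT; rewrite yC => yU; rewrite -(rpredBl _ yV).
Qed.

(** The hull of v consists of the class of v and of classes of elements with a
    strictly smaller hull, on which the sums are integers by induction. *)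
Lemma sum_atom_int (y : V -> rat) v :
  (forall U, U \in T -> \sum_(u in U) y u \is a Num.int) ->
  \sum_u y u \is a Num.int -> \sum_(u | hull u == hull v) y u \is a Num.int.
Proof.
move=> yT yV; have [n] := ubnP #|hull v|; elim: n v => // n IHn v le_n.
have := sum_hull_int v yT yV.
rewrite (sum_hull_closed _ (fun u => @hull_closed u v)).
rewrite (bigD1 (hull v)) ?imset_f ?hull_refl //=.
rewrite rpredDr // rpred_sum // => _ /andP[/imsetP[u uv ->] neq].
apply: IHn; rewrite -ltnS; apply: leq_trans le_n; rewrite ltnS proper_card //.
by rewrite properEneq neq hull_closed.
Qed.

End Hull.

(** * Vectors that vanish on two partitions *)

Section Balanced.

Local Open Scope ring_scope.

Lemma fibre_card_ge2 (V I : finType) (F : {set V}) (h : V -> I) :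
  (forall v, v \in F -> exists2 u, u \in F :\ v & h u = h v) ->
  (#|h @: F|.*2 <= #|F|)%N.
Proof.
move=> twin; rewrite -[#|F|]sum1_card (partition_big_imset h) /= -muln2.
rewrite -sum_nat_const; apply: leq_sum => _ /imsetP[v vF ->].
have [u /setD1P[uv uF] huv] := twin v vF.
rewrite (bigD1 v) ?vF ?eqxx //= (bigD1 u) ?uF ?huv ?eqxx //=.
Qed.

(** This replaces the search for an alternating cycle in the bipartite graph
    whose nodes are the fibres and whose edges are the elements of F: the
    incidence matrix has at least as many rows (edges) as columns (nodes), and
    its columns are dependent since each edge has one end on either side. *)
Lemma fibre_balanced (V I1 I2 : finType) (F : {set V})
    (h1 : V -> I1) (h2 : V -> I2) :
  F != set0 ->
  (forall v, v \in F -> exists2 u, u \in F :\ v & h1 u = h1 v) ->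
  (forall v, v \in F -> exists2 u, u \in F :\ v & h2 u = h2 v) ->
  exists z : V -> rat,
    [/\ exists v, z v != 0, forall v, v \notin F -> z v = 0,
        forall i, \sum_(v | h1 v == i) z v = 0
      & forall i, \sum_(v | h2 v == i) z v = 0].
Proof.
move=> F0 /fibre_card_ge2 c1 /fibre_card_ge2 c2.
pose inc (I : finType) (h : V -> I) : 'M[rat]_(#|F|, #|h @: F|) :=
  \matrix_(i, j) (h (enum_val i) == enum_val j)%:R.
have inc1 (I : finType) (h : V -> I) :
    inc I h *m const_mx 1 = const_mx 1 :> 'cV_#|F|.
  apply/colP => i; rewrite !mxE.
  have hi : h (enum_val i) \in h @: F by rewrite imset_f ?enum_valP.
  rewrite (bigD1 (enum_rank_in hi (h (enum_val i)))) //= !mxE.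
  rewrite enum_rankK_in // eqxx mulr1 big1 ?addr0 // => j.
  rewrite !mxE mulr1 -(inj_eq enum_val_inj) enum_rankK_in // eq_sym.
  by move=> /negPf ->.
pose M := row_mx (inc _ h1) (inc _ h2).
have Mw : M *m col_mx (const_mx 1) (- const_mx 1) = 0 :> 'cV_#|F|.
  by rewrite mul_row_col mulmxN !inc1 subrr.
(* If the rows were free there would be as many rows as columns, so the columns
   would be free as well, against Mw. *)
have /rowV0Pn[z /sub_kermxP zM z0] : kermx M != 0.
  rewrite kermx_eq0; apply/negP => freeM.
  have := rank_leq_col M; rewrite (eqP freeM) => leF.
  have eqF : #|F| = (#|h1 @: F| + #|h2 @: F|)%N by lia.
  have : row_full M by rewrite /row_full (eqP freeM) eqF.
  move=> /row_fullP[B BM].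
  have /colP w0: col_mx (const_mx 1) (- const_mx 1) = 0
    :> 'cV[rat]_(#|h1 @: F| + #|h2 @: F|).
    by rewrite -[LHS]mul1mx -BM -mulmxA Mw mulmx0.
  have [v vF] := set0Pn _ F0.
  have := w0 (lshift _ (enum_rank_in (imset_f h1 vF) (h1 v))).
  by rewrite col_mxEu !mxE => /eqP; rewrite oner_eq0.
pose x v := \sum_(i : 'I_#|F| | enum_val i == v) z 0 i.
have xE i : x (enum_val i) = z 0 i.
  by rewrite /x (big_pred1 i) // => j; rewrite (inj_eq enum_val_inj).
have x0 v : v \notin F -> x v = 0.
  by move=> vF; rewrite /x big1 // => j /eqP jv; rewrite -jv enum_valP in vF.
have balanced (I : finType) (h : V -> I) i :
    z *m inc _ h = 0 -> \sum_(v | h v == i) x v = 0.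
  move=> zh; rewrite (bigID (mem F)) /= [X in _ + X]big1 ?addr0; last first.
    by move=> v /andP[_ /x0].
  have [ih|ih] := boolP (i \in h @: F); last first.
    rewrite big1 // => v /andP[/eqP hv vF].
    by rewrite -hv imset_f in ih.
  have /rowP/(_ (enum_rank_in ih i)) := zh; rewrite !mxE; apply: etrans.
  rewrite [LHS](eq_bigl (fun v => (v \in F) && (h v == i))) => [|v]; last first.
    by rewrite andbC.
  rewrite big_mkcondr big_enum_val /=.
  apply: eq_bigr => j _; rewrite !mxE enum_rankK_in // xE.
  by case: eqP; rewrite ?mulr1 ?mulr0.
move: zM; rewrite /M mul_mx_row -row_mx0 => /eq_row_mx[z1 z2].
exists x; split=> //; try by move=> i; apply: balanced.
have [j zj] : exists j, z 0 j != 0.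
  apply/existsP; apply: contraNT z0; rewrite negb_exists => /forallP z0.
  by apply/eqP/rowP => j; rewrite mxE; apply/eqP; rewrite -[_ == _]negbK.
by exists (enum_val j); rewrite xE.
Qed.

End Balanced.

(** * Integral points in the intersection of two crossing submodular systems *)

Section Rounding.

Local Open Scope ring_scope.

Lemma sum_setIU (V : finType) (R : nmodType) (f : V -> R) (X Y : {set V}) :
  \sum_(v in X :&: Y) f v + \sum_(v in X :|: Y) f v
  = \sum_(v in X) f v + \sum_(v in Y) f v.
Proof.
rewrite (big_setID (A := X) Y) /= (big_setID (A := X :|: Y) Y) /=.
rewrite (setIidPr (subsetUr X Y)) setDUl setDv setU0 -!addrA.
by congr (_ + _); rewrite addrC.
Qed.

Definition crossing_submodular (V : finType) (F : {set {set V}})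
    (f : {set V} -> int) :=
  forall X Y, X \in F -> Y \in F -> X :&: Y != set0 -> X :|: Y != [set: V] ->
  [/\ X :&: Y \in F, X :|: Y \in F & f (X :&: Y) + f (X :|: Y) <= f X + f Y].

(** The index in bool selects one of the two systems. *)
Variables (V : finType) (C : bool -> {set {set V}}).
Variable g : bool -> {set V} -> int.
Hypothesis g_submod : forall b, crossing_submodular (C b) (g b).
(** Bounds on singletons make the polyhedron bounded.  In a one-element V the
   condition that y has total 0 takes their place. *)
Hypothesis C_single :
  forall v, [set v] != [set: V] -> exists b, [set v] \in C b.

Definition feasible (y : V -> rat) :=
  \sum_v y v = 0 /\
  forall b U, U \in C b -> \sum_(v in U) y v <= (g b U)%:~R.

Definition tight (y : V -> rat) b : {set {set V}} :=
  [set U in C b | \sum_(v in U) y v == (g b U)%:~R].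

Lemma tight_crossing y b X Y : feasible y ->
  X \in tight y b -> Y \in tight y b ->
  X :&: Y != set0 -> X :|: Y != [set: V] -> X :&: Y \in tight y b.
Proof.
move=> [_ y_le]; rewrite !inE => /andP[XC /eqP yX] /andP[YC /eqP yY] XY0 XYT.
have [IC UC g_le] := g_submod XC YC XY0 XYT; rewrite IC /=.
have := sum_setIU y X Y; rewrite yX yY => y_eq.
have := y_le _ _ IC; have := y_le _ _ UC.
move: g_le; rewrite -(ler_int rat) !rmorphD /= => *.
by apply/eqP; lra.
Qed.

(** The value of y on a class is an integer, so a class that contains a
    non-integral coordinate contains another one. *)
Lemma tight_direction y v0 : feasible y -> y v0 \isn't a Num.int ->
  exists z : V -> rat, [/\ exists v, z v != 0, \sum_v z v = 0
    & forall b U, U \in tight y b -> \sum_(v in U) z v = 0].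
Proof.
move=> fy y_v0; have [y_sum _] := fy.
pose F := [set v | y v \isn't a Num.int].
have twin b v : v \in F ->
    exists2 u, u \in F :\ v & hull (tight y b) u = hull (tight y b) v.
  rewrite inE => yv.
  have : \sum_(u | hull (tight y b) u == hull (tight y b) v) y u \is a Num.int.
    apply: sum_atom_int => [X Y|U|]; first exact: tight_crossing.
      by rewrite inE => /andP[_ /eqP->]; apply: rpred_int.
    by rewrite y_sum rpred0.
  rewrite (bigD1 v) //= => atomN.
  have [u /andP[huv uv] yu] : exists2 u,
      (hull (tight y b) u == hull (tight y b) v) && (u != v)
      & y u \isn't a Num.int.
    apply/exists_inP; apply: contraNT yv.
    rewrite negb_exists_in => /forall_inP yint.
    move: atomN; rewrite rpredDr //.
    by apply: rpred_sum => u /yint; rewrite negbK.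
  by exists u; [rewrite !inE uv | apply/eqP].
have [||| z [z0 _ z1 z2]] := fibre_balanced (F := F) (h1 := hull (tight y true))
  (h2 := hull (tight y false)).
- by apply/set0Pn; exists v0; rewrite inE.
- exact: twin.
- exact: twin.
have zb b i : \sum_(v | hull (tight y b) v == i) z v = 0 by case: b.
exists z; split=> // [|b U UT].
  by rewrite (partition_big (hull (tight y true)) predT) //= big1.
rewrite (@sum_hull_closed _ (tight y b)) ?big1 // => u uU.
exact: hull_sub.
Qed.

(** Some coordinate of z is positive as z has total 0, so the bound on that
    singleton stops the motion.  The step length is the least ratio of slack to
    speed over the constraints on which z is positive. *)
Lemma tight_step (y z : V -> rat) :
  feasible y -> (exists v, z v != 0) -> \sum_v z v = 0 ->
  (forall b U, U \in tight y b -> \sum_(v in U) z v = 0) ->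
  exists2 y', feasible y' & (forall b, tight y b \subset tight y' b) /\
    exists b, tight y b \proper tight y' b.
Proof.
move=> [y_sum y_le] [v zv] z_sum z_tight.
have [w zw] : exists w, 0 < z w.
  apply/existsP; apply: contraNT zv; rewrite negb_exists => /forallP zle.
  have : \sum_u (- z u) = 0 by rewrite sumrN z_sum oppr0.
  move=> /eqP; rewrite psumr_eq0 => [/allP/(_ v)|u _].
    by rewrite mem_index_enum oppr_eq0; apply.
  by rewrite oppr_ge0 leNgt.
have wT : [set w] != [set: V].
  apply: contraTneq zw => wT; rewrite -leNgt.
  have <- : \sum_(u in [set w]) z u = z w by exact: big_set1.
  by rewrite wT (eq_bigl predT) ?z_sum // => u; rewrite inE.
have [b0 wC] := C_single wT.
pose zs (p : bool * {set V}) := \sum_(u in p.2) z u.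
pose ys (p : bool * {set V}) := \sum_(u in p.2) y u.
pose gs (p : bool * {set V}) : rat := (g p.1 p.2)%:~R.
pose P (p : bool * {set V}) := (p.2 \in C p.1) && (0 < zs p).
pose tm p := (gs p - ys p) / zs p.
have Pp0 : P (b0, [set w]) by rewrite /P /zs /= wC big_set1.
have [[b U] /andP[/= UC zU] minU] := Order.TotalTheory.arg_minP tm Pp0.
set t := tm (b, U) in minU.
have sumy' (W : {set V}) : \sum_(u in W) (y u + t * z u) =
    \sum_(u in W) y u + t * \sum_(u in W) z u.
  by rewrite big_split mulr_sumr.
have t0 : 0 <= t.
  by rewrite /t /tm divr_ge0 ?(ltW zU) // subr_ge0; apply: y_le.
have tightS b' : tight y b' \subset tight (fun u => y u + t * z u) b'.
  apply/subsetP => W Wt; move: (Wt); rewrite !inE sumy' (z_tight _ _ Wt).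
  by rewrite mulr0 addr0.
exists (fun u => y u + t * z u).
  split=> [|b' W WC].
    by rewrite big_split -mulr_sumr /= y_sum z_sum mulr0 addr0.
  rewrite sumy'; have [zW|zW] := ltP 0 (\sum_(u in W) z u); last first.
    apply: le_trans (y_le _ _ WC); rewrite gerDl; exact: mulr_ge0_le0.
  rewrite -lerBrDl -ler_pdivlMr //.
  by apply: (minU (b', W)); rewrite /P /= WC.
split=> //; exists b; rewrite properE tightS; apply/subsetPn; exists U.
  rewrite inE UC sumy' /=; apply/eqP; rewrite /t /tm /zs /ys /gs /=.
  by rewrite divfK ?gt_eqF //; lra.
by apply/negP => /z_tight zU0; rewrite /zs /= zU0 ltxx in zU.
Qed.

(** The intersection theorem for base polyhedra, in the form: a rational
    solution yields an integral one. *)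
Lemma crossing_rounding y : feasible y ->
  exists x : V -> int, \sum_v x v = 0 /\
    forall b U, U \in C b -> \sum_(v in U) x v <= g b U.
Proof.
pose loose y := (\sum_b #|~: tight y b|)%N.
have [n] := ubnP (loose y); elim: n y => // n IHn y le_n fy.
have [/forallP yint|] := boolP [forall v, y v \is a Num.int].
  have yE v : y v = (Num.floor (y v))%:~R by rewrite floorK.
  have yS (P : pred V) :
      (\sum_(v | P v) Num.floor (y v))%:~R = \sum_(v | P v) y v.
    by rewrite rmorph_sum; apply: eq_bigr => v _; rewrite /= -yE.
  have [y_sum y_le] := fy.
  exists (fun v => Num.floor (y v)); split=> [|b U UC].
    by apply/eqP; rewrite -(intr_eq0 rat) yS y_sum.
  by rewrite -(ler_int rat) yS y_le.
rewrite negb_forall => /existsP[v yv].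
have [z [z0 z_sum zt]] := tight_direction fy yv.
have [y' fy' [sub [b prop]]] := tight_step fy z0 z_sum zt.
apply: (IHn y') => //; rewrite -ltnS; apply: leq_trans le_n; rewrite ltnS.
have le b' : (#|~: tight y' b'| <= #|~: tight y b'|)%N.
  by apply: subset_leq_card; rewrite setCS.
have lt : (#|~: tight y' b| < #|~: tight y b|)%N.
  by apply: proper_card; rewrite properC.
rewrite /loose (bigD1 b) //= [X in (_ < X)%N](bigD1 b) //=.
by rewrite -addSn leq_add // leq_sum.
Qed.

End Rounding.

(** * Integral vectors as net outflows of arc sets *)

Section Realization.

Local Open Scope ring_scope.

Variable D : digraph.
Implicit Types (J : {set arcs D}) (U : {set vertices D}) (u v w : vertices D).

Definition net J v : int :=
  \sum_(a in J) ((arc_tail a == v)%:R - (arc_head a == v)%:R).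

Lemma sum_net J U : \sum_(v in U) net J v = (dout J U)%:Z - (din J U)%:Z.
Proof.
have ind x : \sum_(v in U) (x == v)%:R = (x \in U)%:R :> int.
  have [xU|xU] := boolP (x \in U).
    rewrite (bigD1 x) //= eqxx big1 ?addr0 // => v /andP[_ /negPf].
    by rewrite eq_sym => ->.
  by rewrite big1 // => v vU; case: eqP => // xv; rewrite xv vU in xU.
have card (S : {set arcs D}) : \sum_(a in J) (a \in S)%:R = #|S :&: J|%:Z.
  rewrite -sum1_card -natz natr_sum.
  rewrite [RHS](eq_bigl (fun a => (a \in J) && (a \in S))) => [|a].
    by rewrite big_mkcondr; apply: eq_bigr => a _; case: (a \in S).
  by rewrite inE andbC.
rewrite exchange_big /= /dout /din -!card -sumrB; apply: eq_bigr => a _.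
rewrite sumrB !ind !inE.
by case: (arc_tail a \in U); case: (arc_head a \in U).
Qed.

Lemma sum_netT J : \sum_v net J v = 0.
Proof.
have := sum_net J setT; rewrite (eq_bigl predT) => [->|v]; last by rewrite inE.
rewrite /dout /din.
have -> : delta_out setT = set0 :> {set arcs D} by apply/setP=> a; rewrite !inE.
have -> : delta_in setT = set0 :> {set arcs D} by apply/setP=> a; rewrite !inE.
by rewrite !set0I cards0.
Qed.

(** Changing whether a single arc belongs to J can add 1 to net J at u and
    subtract 1 at v. *)
Definition residual J u v : bool :=
  [exists a, if a \in J then (arc_head a == u) && (arc_tail a == v)
             else (arc_tail a == u) && (arc_head a == v)].

Definition flip (a : arcs D) J := if a \in J then J :\ a else a |: J.

Lemma net_setU1 (a : arcs D) J v : a \notin J ->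
  net (a |: J) v = net J v + (arc_tail a == v)%:R - (arc_head a == v)%:R.
Proof. by move=> aJ; rewrite /net big_setU1 //= addrC addrA. Qed.

Lemma net_flip (a : arcs D) J u v w :
  (if a \in J then (arc_head a == u) && (arc_tail a == v)
             else (arc_tail a == u) && (arc_head a == v)) ->
  net (flip a J) w = net J w + (u == w)%:R - (v == w)%:R.
Proof.
rewrite /flip; case: ifPn => aJ /andP[/eqP <- /eqP <-]; last exact: net_setU1.
by rewrite -{2}(setD1K aJ) net_setU1 ?setD11 //; lia.
Qed.

(** Arcs are changed one at a time, from the end of the path.  The second
    conclusion ensures that the first arc is still in its original state when
    its turn comes: it has an end outside the rest of the path. *)
Lemma path_flip J u p : path (residual J) u p -> uniq (u :: p) ->
  exists2 J', forall w, net J' w = net J w + (u == w)%:R - (last u p == w)%:R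
    & forall a, (arc_tail a \notin u :: p) || (arc_head a \notin u :: p) ->
        (a \in J') = (a \in J).
Proof.
elim: p u => [|v p IHp] u /=.
  by move=> _ _; exists J => // w; rewrite addrK.
move=> /andP[/existsP[a uva] vp] /andP[uN vp_uniq].
have [J1 netJ1 memJ1] := IHp v vp vp_uniq.
have aJ1 : (a \in J1) = (a \in J).
  apply: memJ1; move: uva.
  by case: ifP => _ /andP[/eqP -> _]; rewrite uN ?orbT.
exists (flip a J1) => [w|b].
  by rewrite (@net_flip _ _ u v) ?aJ1 // netJ1; lia.
move=> bN; rewrite -memJ1; last first.
  by move: bN; rewrite !inE !negb_or => /orP[] /and3P[_ -> ->]; rewrite ?orbT.
have ba : b != a.
  apply: contraTneq bN => ->; move: uva.
  by case: ifP => _ /andP[/eqP -> /eqP ->]; rewrite !inE !eqxx ?orbT.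
by rewrite /flip; case: ifP; rewrite !inE ?(negPf ba).
Qed.

(** Take J minimizing the total deviation of net J from y.  If net J is not y,
    some vertex s has positive excess, and no vertex of negative excess can be
    reached from s in the residual graph, for flipping a path would reduce the
    deviation.  Then the set R of reachable vertices has positive total excess
    although J contains all arcs leaving R and none entering it, that is,
    y(R) > d^+(R). *)
Lemma realize_net (y : vertices D -> int) :
  \sum_v y v = 0 -> (forall U, \sum_(v in U) y v <= #|delta_out U|%:Z) ->
  exists J, forall v, net J v = y v.
Proof.
move=> y_sum y_le.
pose e J v : int := y v - net J v.
pose phi J := (\sum_v `|e J v|)%N.
have [J _ minJ] := arg_minnP phi (erefl : predT (set0 : {set arcs D})).
exists J; have esum : \sum_v e J v = 0 by rewrite sumrB y_sum sum_netT subr0.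
have [|/existsP[s es]] := boolP [forall s, e J s <= 0].
  move=> /forallP e_le v.
  have : \sum_v (- e J v) = 0 by rewrite sumrN esum oppr0.
  move=> /eqP; rewrite psumr_eq0 => [/allP/(_ v)|u _]; last first.
    by rewrite oppr_ge0.
  by rewrite mem_index_enum /e /= => /(_ isT) /eqP; lia.
rewrite -ltNge in es.
pose R := [set v | connect (residual J) s v].
have RJ u v : residual J u v -> u \in R -> v \in R.
  by rewrite !inE => uv su; apply: connect_trans su (connect1 uv).
have doutR : dout J R = #|delta_out R|.
  rewrite /dout (setIidPl _) //; apply/subsetP => a; rewrite inE.
  move=> /andP[tR]; apply: contraNT => aJ; apply: RJ tR.
  by apply/existsP; exists a; rewrite (negPf aJ) !eqxx.
have dinR : din J R = 0%N.
  rewrite /din; apply/eqP; rewrite cards_eq0 -subset0; apply/subsetP => a.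
  rewrite !inE => /andP[/andP[hR tR] aJ]; case/negP: tR.
  have := RJ (arc_head a) (arc_tail a); rewrite !inE; apply => //.
  by apply/existsP; exists a; rewrite aJ !eqxx.
have eR : \sum_(v in R) e J v <= 0.
  by rewrite sumrB sum_net doutR dinR subr0 subr_le0 y_le.
have [t tR et] : exists2 t, t \in R & e J t < 0.
  apply/exists_inP; apply: contraLR eR.
  rewrite negb_exists_in -ltNge => /forall_inP e_ge.
  rewrite (bigD1 s) ?inE ?connect0 //=; apply: ltr_pwDl => //.
  by apply: sumr_ge0 => v /andP[/e_ge]; rewrite -leNgt.
move: tR; rewrite inE => /connectP[p' p'path tE].
move: tE; case: (shortenP p'path) => p ppath puniq _ tE {p' p'path}.
have [J' netJ' _] := path_flip ppath puniq.
have st : s != t by apply: contraTneq es => ->; rewrite -leNgt ltW.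
have eJ' v : e J' v = e J v - (s == v)%:R + (t == v)%:R.
  by rewrite /e netJ' -tE; lia.
have := minJ J' isT; rewrite leqNgt => /negP[].
rewrite /phi (bigD1 s) //= [X in (_ < X)%N](bigD1 s) //= -addSn leq_add //.
  by rewrite eJ' eqxx eq_sym (negPf st); lia.
apply: leq_sum => v vs; rewrite eJ' eq_sym (negPf vs).
by case: eqP => [<-|_]; lia.
Qed.

End Realization.

(** * The two systems of a digraph *)

Section Cuts.

Local Open Scope ring_scope.

Variable D : digraph.
Implicit Types (X Y U : {set vertices D}).
Local Notation dp U := (dout [set: arcs D] U).
Local Notation dm U := (din [set: arcs D] U).

Lemma doutT U : dp U = #|delta_out U|. Proof. by rewrite /dout setIT. Qed.

Lemma doutC (J : {set arcs D}) U : dout J (~: U) = din J U.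
Proof.
rewrite /dout /din; congr #|pred_of_set (_ :&: _)|.
by apply/setP => a; rewrite !inE negbK andbC.
Qed.

Lemma dinC (J : {set arcs D}) U : din J (~: U) = dout J U.
Proof. by rewrite -doutC setCK. Qed.

Lemma dout_submod X Y : (dp (X :&: Y) + dp (X :|: Y) <= dp X + dp Y)%N.
Proof.
have dpE U : dp U = (\sum_a (a \in delta_out U))%N.
  by rewrite doutT -sum1_card big_mkcond.
rewrite !dpE -!big_split /=; apply: leq_sum => a _; rewrite !inE.
by do 4!case: (_ \in _).
Qed.

Lemma delta_in_IU X Y : delta_in X = set0 -> delta_in Y = set0 ->
  delta_in (X :&: Y) = set0 /\ delta_in (X :|: Y) = set0.
Proof.
move=> /setP X0 /setP Y0; split; apply/setP => a; have := X0 a; have := Y0 a;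
by rewrite !inE; do 4!case: (_ \in _).
Qed.

Lemma nontrivialP U : reflect (nontrivial U) ((U != set0) && (U != setT)).
Proof. by rewrite /nontrivial properT; apply: andP. Qed.

Lemma nontrivialC U : nontrivial U -> nontrivial (~: U).
Proof.
move=> /nontrivialP/andP[U0 UT]; apply/nontrivialP/andP; split.
  by apply: contraNneq UT => UC; rewrite -[U]setCK UC setC0.
by apply: contraNneq U0 => UC; rewrite -[U]setCK UC setCT.
Qed.

(** The hypothesis at the complement of U, multiplied by k/tau, is the first
    inequality at U for the vector (k/tau) net A.  When no arc enters U the
    hypothesis at U reads tau <= d^+(U), which multiplied by 1 - k/tau is the
    second inequality. *)
Lemma integral_net (tau k : nat) :
  (0 < k <= tau)%N ->
  (forall U, nontrivial U ->
     tau%:R <= (dp U)%:R + (tau%:R / k%:R - 1) * (dm U)%:R :> rat) ->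
  exists x : vertices D -> int, [/\ \sum_v x v = 0,
    forall U, nontrivial U -> \sum_(v in U) x v <= (dp U)%:Z - k%:Z
  & forall U, nontrivial U -> delta_in U = set0 ->
      \sum_(v in U) x v <= (dp U)%:Z - (tau - k)%N%:Z].
Proof.
move=> /andP[k_gt0 k_le] D_cut.
(* The index true stands for the bounds with k on all nontrivial sets, false for
   the bounds with tau - k on the sets without entering arcs. *)
pose C b : {set {set vertices D}} := [set U | [&& U != set0, U != setT
  & b || (delta_in U == set0)]].
pose g b U : int := (dp U)%:Z - (if b then k else (tau - k)%N)%:Z.
have CP b U : U \in C b -> nontrivial U.
  by rewrite inE => /and3P[U0 UT _]; apply/nontrivialP/andP.
have g_submod b : crossing_submodular (C b) (g b).
  move=> X Y; rewrite !inE => /and3P[X0 XT bX] /and3P[Y0 YT bY] I0 UT.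
  rewrite I0 UT /=; split.
  - rewrite (contraNneq _ XT) => [|IT]; last first.
      by rewrite -subTset -IT subsetIl.
    case: b bX bY => //= /eqP dX /eqP dY.
    by have [-> _] := delta_in_IU dX dY.
  - rewrite (contraNneq _ X0) => [|U0]; last by rewrite -subset0 -U0 subsetUl.
    case: b bX bY => //= /eqP dX /eqP dY.
    by have [_ ->] := delta_in_IU dX dY.
  - by rewrite /g; have := dout_submod X Y; lia.
have C_single v : [set v] != setT -> exists b, [set v] \in C b.
  move=> vT; exists true; rewrite inE vT /= !andbT.
  by apply/set0Pn; exists v; rewrite inE.
pose r : rat := k%:R / tau%:R.
have k0 : (0 : rat) < k%:R by rewrite ltr0n.
have t0 : (0 : rat) < tau%:R by rewrite ltr0n; lia.
have r0 : 0 < r by apply: divr_gt0.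
have rt : r * tau%:R = k%:R by rewrite /r divfK ?gt_eqF.
have rq : r * (tau%:R / k%:R) = 1.
  by rewrite mulrA rt divff ?gt_eqF.
pose y v : rat := r * (net [set: arcs D] v)%:~R.
have y_sum U : \sum_(v in U) y v = r * ((dp U)%:R - (dm U)%:R).
  by rewrite -mulr_sumr -rmorph_sum sum_net /= rmorphB.
have scaled U : nontrivial U ->
    k%:R <= r * (dp U)%:R + (1 - r) * (dm U)%:R :> rat.
  move=> /D_cut; rewrite -(ler_pM2l r0) rt => /le_trans; apply.
  by rewrite le_eqVlt -[in 1 - r]rq; apply/orP; left; apply/eqP; ring.
have fy : feasible C g y.
  split=> [|b U UC].
    by rewrite -mulr_sumr -rmorph_sum sum_netT mulr0.
  rewrite y_sum /g rmorphB /=.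
  have UN := CP _ _ UC.
  move: UC; rewrite inE => /and3P[_ _]; case: b => /= [_|/eqP dU].
    by have := scaled _ (nontrivialC UN); rewrite doutC dinC; lra.
  have := D_cut U UN; rewrite -!pmulrn natrB // /din dU set0I cards0.
  rewrite mulr0 addr0 -subr_ge0 => cut_ge.
  rewrite -subr_ge0; have -> : (dp U)%:R - (tau%:R - k%:R) - r * (dp U)%:R
      = (1 - r) * ((dp U)%:R - tau%:R) :> rat by rewrite -rt; ring.
  by rewrite mulr_ge0 // subr_ge0 ler_pdivrMr // mul1r ler_nat.
have [x [x_sum x_le]] := crossing_rounding g_submod C_single fy.
exists x; split=> // [U /nontrivialP UN|U /nontrivialP UN dU].
  by apply: (x_le true); rewrite inE andbT.
by apply: (x_le false); rewrite inE dU eqxx andbT.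
Qed.

End Cuts.

Theorem theorem14 (tau k : nat) (D : digraph) :
  1 <= k -> k <= tau - 1 ->
  (forall U : {set vertices D}, nontrivial U ->
     (tau%:R <= (dout [set: arcs D] U)%:R
                + (tau%:R / k%:R - 1) * (din [set: arcs D] U)%:R :> rat)%R) ->
  exists J K : {set arcs D},
    [/\ J :|: K = [set: arcs D], J :&: K = set0,
        arc_connected_flip k D J & dijoin D (tau - k) K].
Proof.
move=> k_gt0 k_lt D_cut.
have [|x [x_sum x_flip x_dijoin]] := integral_net _ D_cut; first by lia.
have [//|U|J netJ] := realize_net (y := x).
  have [/nontrivialP UN|] := boolP ((U != set0) && (U != setT)).
    by apply: le_trans (x_flip U UN) _; rewrite doutT; lia.
  rewrite negb_and !negbK => /orP[]/eqP->; first by rewrite big_set0.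
  by rewrite (eq_bigl predT) ?x_sum // => v; rewrite inE.
have netU (U : {set vertices D}) :
    (\sum_(v in U) x v = (dout J U)%:Z - (din J U)%:Z)%R.
  by rewrite -sum_net; apply: eq_bigr => v _.
exists J, (~: J); split; [exact: setUCr | exact: setICr | |].
  apply/arc_connected_flipP => U UN.
  have := x_flip _ (nontrivialC UN); rewrite netU !doutC dinC.
  by lia.
move=> _ [U [UN dU ->]].
have := x_dijoin U UN dU; rewrite netU /din dU set0I cards0 doutT.
by rewrite setIC -setDE cardsD /dout; lia.
Qed.
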